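(* (a) Let $\mathbf{V}$ be a nontrivial variety of lattices. Then the class $\overrightarrow{\mathrm{rel}}(\mathbf{V}^{\mathit{fin}})$ has both the Ramsey property and the ordering property. (b) Let $\mathbf{V}$ be a nontrivial variety of semilattices. Then the class $\overrightarrow{\mathrm{rel}}(\mathbf{V}^{\mathit{fin}})$ has both the Ramsey property and the ordering property.
   Context: A lattice is an algebra $(L,\land,\lor)$ with both operations idempotent, commutative and associative, satisfying the absorption laws; a (meet) semilattice is an algebra $(S,\land)$ with $\land$ idempotent, commutative and associative. A variety is a class of algebras over a fixed algebraic language closed under homomorphic images, subalgebras and arbitrary products; it is nontrivial if it contains an algebra with more than one element. $\mathbf{V}^{\mathit{fin}}$ is the class of finite members of $\mathbf{V}$. For a finite lattice $\mathcal{L}=(L,\land,\lor)$ (respectively a finite semilattice $\mathcal{L}=(L,\land)$), $\mathrm{rel}(\mathcal{L})=(L,\sqsubseteq)$ is the poset with $a\sqsubseteq b$ iff $a\land b=a$. For a variety $\mathbf{V}$ of lattices or of semilattices, $\overrightarrow{\mathrm{rel}}(\mathbf{V}^{\mathit{fin}})$ is the class of all finite structures $(L,\sqsubseteq,\prec)$ such that $(L,\sqsubseteq)=\mathrm{rel}(\mathcal{L})$ for some $\mathcal{L}\in\mathbf{V}^{\mathit{fin}}$ and $\prec$ is any linear order on $L$ extending $\sqsubseteq$ (that is, $a\sqsubseteq b$ and $a\ne b$ imply $a\prec b$). These are relational structures with two binary relations; an embedding is an injective map preserving and reflecting both relations (meets and joins need not be preserved), $\mathcal{A}\hookrightarrow\mathcal{B}$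 means that $\mathcal{A}$ embeds into $\mathcal{B}$, and $\mathcal{A}\le\mathcal{B}$ denotes (induced) substructure. Ramsey property. $\binom{\mathcal{B}}{\mathcal{A}}=\{\tilde{\mathcal{A}}:\tilde{\mathcal{A}}\le\mathcal{B},\ \tilde{\mathcal{A}}\cong\mathcal{A}\}$. Write $\mathcal{C}\longrightarrow(\mathcal{B})^{\mathcal{A}}_k$ if for every partition $\binom{\mathcal{C}}{\mathcal{A}}=\mathcal{X}_1\cup\dots\cup\mathcal{X}_k$ there are $\tilde{\mathcal{B}}\in\binom{\mathcal{C}}{\mathcal{B}}$ and $j$ with $\binom{\tilde{\mathcal{B}}}{\mathcal{A}}\subseteq\mathcal{X}_j$. A class $\mathbf{K}$ of finite structures has the Ramsey property if for all $\mathcal{A},\mathcal{B}\in\mathbf{K}$ with $\mathcal{A}\hookrightarrow\mathcal{B}$ and every integer $k\ge2$ there is $\mathcal{C}\in\mathbf{K}$ with $\mathcal{C}\longrightarrow(\mathcal{B})^{\mathcal{A}}_k$. Ordering property. Let $\mathbf{K}^*$ be a class of finite structures of the form $(\mathcal{A},<)$ with $<$ a linear order on $A$, and let $\mathbf{K}=\{\mathcal{A}:(\mathcal{A},<)\in\mathbf{K}^*\}$ be the class of reducts obtained by forgetting the linear order. $\mathbf{K}^*$ has the ordering property if for every $\mathcal{A}\in\mathbf{K}$ there is $\mathcal{B}\in\mathbf{K}$ such that $(\mathcal{A},<)\hookrightarrow(\mathcal{B},\sqsubset)$ for every linear order $<$ on $A$ with $(\mathcal{A},<)\in\mathbf{K}^*$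 and every linear order $\sqsubset$ on $B$ with $(\mathcal{B},\sqsubset)\in\mathbf{K}^*$. For $\mathbf{K}^*=\overrightarrow{\mathrm{rel}}(\mathbf{V}^{\mathit{fin}})$ the forgotten linear order is $\prec$ and the reducts are the posets $(L,\sqsubseteq)$. *)

(* Defs.v *)
From HB Require Import structures.
From mathcomp Require Import all_boot.

Set Implicit Arguments.
Unset Strict Implicit.
Unset Printing Implicit Defensive.

(** * Algebras and varieties *)

(* [O] is the type of operation symbols of the language. Lattices and
   semilattices only have binary operations, so arities are left out. *)
Record algebra (O : Type) := Algebra {
  carrier :> Type;
  op : O -> carrier -> carrier -> carrier
}.

Definition homomorphism O (A B : algebra O) (h : A -> B) : Prop :=
  forall o x y, h (op o x y) = op o (h x) (h y).

Definition subuniverse O (A : algebra O) (P : A -> Prop) : Prop :=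
  forall o x y, P x -> P y -> P (op o x y).

Definition subalgebra O (A : algebra O) (P : A -> Prop)
    (clP : subuniverse P) : algebra O :=
  Algebra (fun o (x y : {z : A | P z}) =>
    exist P (op o (sval x) (sval y)) (clP o _ _ (svalP x) (svalP y))).

Definition product O (I : Type) (A : I -> algebra O) : algebra O :=
  Algebra (fun o (x y : forall i, A i) => fun i => op o (x i) (y i)).

(* Only nonempty subalgebras are required, so that a variety may, but need
   not, contain the empty algebra. *)
Definition variety O (V : algebra O -> Prop) : Prop :=
  [/\ forall (A B : algebra O) (h : A -> B),
        V A -> homomorphism h -> (forall y, exists x, h x = y) -> V B,
      forall (A : algebra O) (P : A -> Prop) (clP : subuniverse P),
        V A -> (exists x, P x) -> V (subalgebra clP)
    & forall (I : Type) (A : I -> algebra O),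
        (forall i, V (A i)) -> V (product A)].

Definition nontrivial O (V : algebra O -> Prop) : Prop :=
  exists2 A : algebra O, V A & exists x y : A, x <> y.

Variant lattice_op := Meet | Join.
Variant semilattice_op := SMeet.

Definition is_semilattice (A : algebra semilattice_op) : Prop :=
  let meet := @op _ A SMeet in
  [/\ idempotent_op meet, commutative meet & associative meet].

Definition is_lattice (A : algebra lattice_op) : Prop :=
  let meet := @op _ A Meet in
  let join := @op _ A Join in
  [/\ [/\ idempotent_op meet, commutative meet & associative meet],
      [/\ idempotent_op join, commutative join & associative join],
      forall x y, meet x (join x y) = x
    & forall x y, join x (meet x y) = x].

Definition lattice_variety (V : algebra lattice_op -> Prop) : Prop :=
  variety V /\ forall A, V A -> is_lattice A.

Definition semilattice_variety (V : algebra semilattice_op -> Prop) : Prop :=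
  variety V /\ forall A, V A -> is_semilattice A.

(** * Finite relational structures *)

Record fstruct := FStruct {
  dom :> finType;
  sq : rel dom
}.

Record ostruct := OStruct {
  reduct :> fstruct;
  prec : rel reduct
}.

Definition strict_linear_order (T : Type) (lt : rel T) : Prop :=
  [/\ irreflexive lt, transitive lt
    & forall x y, x <> y -> lt x y \/ lt y x].

Definition embedding (A B : ostruct) (f : A -> B) : Prop :=
  [/\ injective f,
      forall x y, sq (f x) (f y) = sq x y
    & forall x y, prec (f x) (f y) = prec x y].

Definition embeds (A B : ostruct) : Prop := exists f : A -> B, embedding f.

Definition isomorphic (A B : ostruct) : Prop :=
  exists2 f : A -> B, embedding f & bijective f.

Definition substructure (C : ostruct) (X : {set C}) : ostruct :=
  @OStruct (@FStruct {x : C | x \in X} (fun x y => sq (val x) (val y)))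
           (fun x y => prec (val x) (val y)).

(* Substructures of [C] are identified with their underlying sets. *)
Definition copy (A C : ostruct) (X : {set C}) : Prop :=
  isomorphic (substructure X) A.

(* A partition of the copies of [A] into [k] (possibly empty) parts is given by
   a colouring; its values on sets which are not copies of [A] are irrelevant.
   The copies of [A] in the substructure on [X] are those contained in [X]. *)
Definition arrows (C B A : ostruct) (k : nat) : Prop :=
  forall chi : {set C} -> 'I_k,
  exists2 X : {set C}, copy B X &
  exists j : 'I_k, forall Y : {set C}, copy A Y -> Y \subset X -> chi Y = j.

Definition Ramsey_property (K : ostruct -> Prop) : Prop :=
  forall A B : ostruct, K A -> K B -> embeds A B ->
  forall k : nat, 2 <= k ->
  exists2 C : ostruct, K C & arrows C B A k.

Definition reducts (K : ostruct -> Prop) (A : fstruct) : Prop :=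
  exists lt : rel A, K (OStruct lt).

Definition ordering_property (K : ostruct -> Prop) : Prop :=
  forall A : fstruct, reducts K A ->
  exists2 B : fstruct, reducts K B &
  forall (ltA : rel A) (ltB : rel B),
    K (OStruct ltA) -> K (OStruct ltB) -> embeds (OStruct ltA) (OStruct ltB).

(** * From varieties to ordered structures *)

(* [S] is rel(L) for the algebra L with operations [f] on the elements of [S];
   as [S] is finite, L is a finite member of [V]. *)
Definition rel_class O (meet : O) (V : algebra O -> Prop) (S : fstruct) : Prop :=
  exists2 f : O -> S -> S -> S, V (Algebra f) &
  forall a b : S, sq a b <-> f meet a b = a.

Definition ordered_rel_class O (meet : O) (V : algebra O -> Prop)
    (S : ostruct) : Prop :=
  [/\ rel_class meet V S,
      strict_linear_order (@prec S)
    & forall a b : S, sq a b -> a <> b -> prec a b].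

(* Main.v *)
Require Import Defs.
From HB Require Import structures.
From Stdlib Require Import ClassicalEpsilon.
From mathcomp Require Import all_boot zify.

Set Implicit Arguments.
Unset Strict Implicit.
Unset Printing Implicit Defensive.

(** A nontrivial variety of lattices or of semilattices contains a two-element
    algebra, hence all of its finite powers, and the posets of these powers are
    the power sets of finite sets ([variety_power]). So the theorem only
    needs to know that finite power sets, with suitable linear extensions, are
    large enough to be Ramsey witnesses for arbitrary finite posets with linear
    extensions ([cube_classes]).

    The linear extension used is the lexicographic order. An embedding of an
    ordered poset A into the power set of n assigns to each point below n
    the set of those elements of A whose image contains that point; this is an
    upset of A, so that the embedding is a word of length n over the alphabet of
    all upsets. If this alphabet is ordered lexicographically too, each word
    that is a rigid surjection (all letters occur, and their first occurrences
    come in increasing order) gives an embedding of A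
    ([word_map_embedding]). Moreover, restricting such an embedding of a poset
    B along an embedding of A into B amounts to composing words with a rigid
    surjection between the alphabets ([word_map_comp]). The Ramsey property thus
    follows from the dual Ramsey theorem of Graham and Rothschild: for every
    colouring of the rigid surjections from n onto m, n large, there is a
    rigid surjection w from n onto l such that all compositions u w have the
    same colour ([dual_Ramsey_theorem]).

    The dual Ramsey theorem is proved by induction on m. The word of a rigid
    surjection onto m + 1 is split at the first occurrence of its last letter:
    behind it the word is arbitrary, and the Hales-Jewett theorem removes the
    influence of this part ([prefix_determined_all]); in front of it there is a
    rigid surjection onto m, to which the induction hypothesis applies
    ([uniform_prefixes]). The Hales-Jewett theorem is proved by Shelah's method
    ([hales_jewett]).

    For the ordering property, an arbitrary linear extension of a power set is
    compared with the lexicographic one, by colouring the two-element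
    antichains ([cube_all_linear_extensions]). *)

(** * Rigid surjections and colourings of words *)

(** A rigid surjection from [n] onto [m]: each value makes its first appearance
    after all smaller ones. It is carried by a function on all of [nat], of
    which only the values below [n] matter, so that composition of rigid
    surjections is composition of functions. *)
Definition rigid (n m : nat) (w : nat -> nat) : Prop :=
  [/\ forall i, i < n -> w i < m,
      forall y, y < m -> exists2 i, i < n & w i = y
    & forall i y, i < n -> y < w i -> exists2 j, j < i & w j = y].

Definition fixes (t : nat) (w : nat -> nat) : Prop := forall i, i < t -> w i = i.

(** Words of length [n] are encoded as functions on [nat]; a colouring of such
    words has to ignore the values from [n] on. *)
Definition local T (n : nat) (chi : (nat -> nat) -> T) : Prop :=
  forall u v, (forall i, i < n -> u i = v i) -> chi u = chi v.

Definition pull T (chi : (nat -> nat) -> T) (w u : nat -> nat) : T :=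
  chi (u \o w).

Lemma local_pull T (n l : nat) (chi : (nat -> nat) -> T) w :
  local n chi -> (forall i, i < n -> w i < l) -> local l (pull chi w).
Proof. by move=> cl wl u v uv; apply: cl => i /wl/uv. Qed.

Lemma rigid_id n : rigid n n id.
Proof. by split=> // [y yn|i y _ yi]; exists y. Qed.

Lemma rigid_comp n l m u w :
  rigid l m u -> rigid n l w -> rigid n m (u \o w).
Proof.
move=> [ub us ur] [wb ws wr]; split=> [i /wb/ub //|y /us[j /ws[i il <-] <-]|].
  by exists i.
move=> i y iN /ur[|j ji <-]; first exact: wb.
by have [i' i'i <-] := wr _ _ iN ji; exists i'.
Qed.

Lemma fixes_comp t u w : fixes t u -> fixes t w -> fixes t (u \o w).
Proof. by move=> fu fw i it /=; rewrite fw // fu. Qed.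

Lemma fixes_le s t w : s <= t -> fixes t w -> fixes s w.
Proof. by move=> st fw i /leq_trans/(_ st)/fw. Qed.

Lemma rigid_first n m w y : rigid n m w -> y < m ->
  exists p, [/\ p < n, w p = y & forall i, i < p -> w i < y].
Proof.
move=> [_ ws wr] /ws[i0 i0n wi0].
have ex : exists i, (i < n) && (w i == y) by exists i0; rewrite i0n wi0 eqxx.
case: (ex_minnP ex) => p /andP[pn /eqP wp] pmin; exists p; split=> // i ip.
case: ltngtP => // [yi|wiy].
  have [|j ji wj] := wr i y _ yi; first by lia.
  by have := pmin j; rewrite wj eqxx; lia.
by have := pmin i; rewrite wiy eqxx; lia.
Qed.

Lemma rigid_prefix n m w p : rigid n m w -> p < n ->
  (forall i, i < p -> w i < w p) -> rigid p (w p) w.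
Proof.
move=> [_ _ wr] pn pf; split=> // [y|i y ip]; first exact: wr.
by apply: wr; lia.
Qed.

Lemma rigid0 n m w : rigid n m w -> 0 < n -> w 0 = 0.
Proof.
by move=> [_ _ wr] n0; case E: (w 0) => [//|x]; have [|j] := wr 0 x n0; lia.
Qed.

(** Many of the uniformity properties needed below are of the form: for each
    position [p], the colour of a word does not react to some change that
    concerns position [p]. They can be arranged one position at a time, the
    substitution made for [p] leaving the positions below [p] alone; [Q] records
    whatever else the step has to say so that the properties [P q], [q < p],
    survive it. The length needed for the last position is fixed first, and
    becomes the target length for the remaining ones. *)
Lemma fusion T t (P : nat -> nat -> ((nat -> nat) -> T) -> Prop)
    (Q : nat -> (nat -> nat) -> Prop) q L :
  (forall p L, t <= p -> p < L -> exists2 N, L <= N &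
     forall chi, local N chi ->
     exists v, [/\ rigid N L v, fixes p v, Q p v & P p L (pull chi v)]) ->
  (forall p q N L chi v, t <= q -> q < p -> P q N chi ->
     rigid N L v -> fixes p v -> Q p v -> P q L (pull chi v)) ->
  q <= L -> exists2 N, L <= N &
    forall chi, local N chi -> exists w,
    [/\ rigid N L w, fixes t w & forall p, t <= p -> p < q -> P p L (pull chi w)].
Proof.
move=> step keep; elim: q L => [|q IH] L qL.
  by exists L => // chi _; exists id; split=> //; exact: rigid_id.
have [qt|tq] := ltnP q t.
  have [N LN HN] := IH L (ltnW qL); exists N => // chi /HN[w [rw fw Pw]].
  by exists w; split=> // p tp pq; apply: Pw => //; lia.
have [M LM HM] := step q L tq qL.
have [N MN HN] := IH M (leq_trans (ltnW qL) LM).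
exists N => [|chi /[dup] cl /HN[w [rw fw Pw]]]; first exact: leq_trans MN.
have [wb _ _] := rw.
have [v [rv fv Qv Pv]] := HM _ (local_pull cl wb).
exists (v \o w); split; first exact: rigid_comp rw.
  by apply: fixes_comp => //; apply: fixes_le fv.
move=> p tp; rewrite ltnS leq_eqVlt => /orP[/eqP->|pq]; first exact: Pv.
exact: keep tp pq (Pw p tp pq) rv fv Qv.
Qed.

(** * The Hales-Jewett theorem *)

(** The padding value [a] is an element of 'I_a.+1, so that an extension still
    takes its values in the alphabet. *)
Definition extend (a n : nat) (x : {ffun 'I_n -> 'I_a.+1}) (i : nat) : nat :=
  if insub i is Some j then x j else a.

Lemma extend_restrict a n u : (forall i, i < n -> u i <= a) ->
  exists x : {ffun 'I_n -> 'I_a.+1},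
    extend x =1 fun i => if i < n then u i else a.
Proof.
move=> ub; exists [ffun j : 'I_n => inord (u j)] => i.
rewrite /extend; case: insubP => [j -> <-|/negbTE-> //].
by rewrite ffunE inordK // ltnS ub.
Qed.

Lemma pigeonhole (T : finType) (f : nat -> T) :
  exists i j, [/\ i < j, j <= #|T| & f i = f j].
Proof.
have: ~~ injectiveb (fun i : 'I_#|T|.+1 => f i).
  by apply/negP=> /injectiveP/leq_card; rewrite card_ord ltnn.
case/injectivePn=> i [j ij fij].
wlog lij: i j ij fij / i < j => [W|].
  have [lt|gt|/val_inj eq] := ltngtP i j; first exact: (W i j).
    by apply: (W j i) => //; rewrite eq_sym.
  by rewrite eq eqxx in ij.
by exists i, j; split=> //; have := ltn_ord j; lia.
Qed.

(** For words over the alphabet [t.+1] that start with [0, 1, ..., t], exchanging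
    the two last letters [t] and [t.-1] at position [p] leaves the colour
    unchanged. *)
Definition insensitive T t p L (chi : (nat -> nat) -> T) : Prop :=
  forall u v, (forall i, i < L -> u i <= t) -> fixes t.+1 u ->
    (forall i, i < L -> i != p -> u i = v i) -> u p = t -> v p = t.-1 ->
    chi u = chi v.

(** Shelah's argument. Position [p] is blown up to a block of [h.+1] positions, and
    [x i] fills this block with [i] letters [t] followed by letters [t.-1]. Each
    [x i] gives a colouring of all contexts, and there are at most [h] such
    colourings, so that two of them agree, for [i < j] say. In [v] the block has
    [p] from place [i] up to place [j]: setting [p] to [t] yields [x j], and
    setting it to [t.-1] yields [x i]. *)
Lemma insensitive_step (T : finType) t p L : t < p -> p < L ->
  exists2 N, L <= N & forall chi : (nat -> nat) -> T, local N chi ->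
    exists v, [/\ rigid N L v, fixes p v, forall i, t < v i < p -> v i = i &
      insensitive t p L (pull chi v)].
Proof.
move=> tp pL.
pose K := {ffun {ffun 'I_L -> 'I_t.+1} -> T}.
pose h := #|K|.
exists (L + h) => [|chi cl]; first by lia.
pose x i s := if s < p then s else if s < p + i then t
              else if s <= p + h then t.-1 else s - h.
pose F i : K := [ffun c => chi (extend c \o x i)].
have [i [j [ij jh Fij]]] := pigeonhole F; rewrite -/h in jh.
pose v s := if s < p then s else if s < p + i then t
            else if s < p + j then p
            else if s <= p + h then t.-1 else s - h.
have vE s : s < p -> v s = s by rewrite /v => ->.
have vp : v (p + i) = p by rewrite /v; do !case: ifP; lia.
have vS s : p < s -> v (s + h) = s by rewrite /v; do !case: ifP; lia.
exists v; split=> //.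
- split=> [s sn|y yL|s y sn].
  + by rewrite /v; do !case: ifP; lia.
  + case: (ltngtP y p) => [yp|py|->].
    * by exists y; [lia|rewrite vE].
    * by exists (y + h); [lia|rewrite vS].
    * by exists (p + i); [lia|].
  + case: (ltngtP y p) => [yp|py|->].
    * move=> yv; exists y; last exact: vE.
      by move: yv; rewrite /v; do !case: ifP; lia.
    * move=> yv; exists (y + h); last exact: vS.
      by move: yv; rewrite /v; do !case: ifP; lia.
    * move=> yv; exists (p + i); last by [].
      by move: yv; rewrite /v; do !case: ifP; lia.
- by move=> s; rewrite /v; do !case: ifP; lia.
move=> a b ab fa eab ap bp.
have [c cE] := extend_restrict ab.
have at_ : a t = t by rewrite fa.
have at1 : a t.-1 = t.-1 by rewrite fa //; lia.
have -> : pull chi v a = F j c.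
  rewrite ffunE; apply: cl => s sn /=; rewrite cE /v /x.
  case: (ltnP s p) => sp; first by rewrite ifT //; lia.
  case: (ltnP s (p + i)) => spi; first by rewrite !ifT //; lia.
  case: (ltnP s (p + j)) => spj; first by rewrite ifT ?ap ?at_ //; lia.
  by case: (leqP s (p + h)) => sph; rewrite ifT //; lia.
have -> : pull chi v b = F i c.
  rewrite ffunE; apply: cl => s sn /=; rewrite cE /v /x.
  case: (ltnP s p) => sp; first by rewrite ifT -?eab //; lia.
  case: (ltnP s (p + i)) => spi; first by rewrite ifT -?eab //; lia.
  case: (ltnP s (p + j)) => spj.
    by rewrite ifT ?ifT ?bp ?at1 //; lia.
  by case: (leqP s (p + h)) => sph; rewrite ifT -?eab //; lia.
by rewrite Fij.
Qed.

Lemma insensitive_collapse T t L (chi : (nat -> nat) -> T) u :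
  0 < t -> local L chi ->
  (forall p, t < p -> p < L -> insensitive t p L chi) ->
  (forall i, i < L -> u i <= t) -> fixes t.+1 u ->
  chi u = chi (fun i => if i <= t then i else minn (u i) t.-1).
Proof.
move=> t0 cl ins ub fu.
pose v q i := if t < i < q then minn (u i) t.-1 else u i.
suff H q : q <= L -> chi u = chi (v q).
  rewrite (H L) //; apply: cl => i iL; rewrite /v iL andbT.
  by case: (leqP i t) => // it; rewrite fu.
elim: q => [|q IH] qL; first by apply: cl => i _; rewrite /v ltn0 andbF.
rewrite IH; last exact: ltnW.
have [qt|tq] := leqP q t; first by apply: cl => i iL; rewrite /v; do !case: ifP; lia.
have vu i : i != q -> v q i = v q.+1 i by rewrite /v; do !case: ifP; lia.
have [uq|uq] := ltnP (u q) t.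
  apply: cl => i iL; have [->|/vu//] := eqVneq i q.
  by rewrite /v; do !case: ifP; lia.
have {}uq : u q = t by have := ub q qL; lia.
apply: (ins q) => //.
- by move=> i iL; have := ub i iL; rewrite /v; do !case: ifP; lia.
- by move=> i it; rewrite /v; have := fu i it; do !case: ifP; lia.
- by move=> i _ /vu.
- by rewrite /v; do !case: ifP; lia.
- by rewrite /v; do !case: ifP; lia.
Qed.

(** The Hales-Jewett theorem in its multidimensional form, with the letters of
    the alphabet treated as the first [t] coordinates. For an alphabet with one
    more letter, colours are first made insensitive to the exchange of the last
    two letters; on words over the smaller alphabet the induction hypothesis
    then applies, and replacing the last letter by the one before it brings
    every word of the subspace back to that case. *)
Theorem hales_jewett t l (T : finType) : 0 < t -> t <= l ->
  exists2 n, l <= n & forall chi : (nat -> nat) -> T, local n chi ->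
    exists w, [/\ rigid n l w, fixes t w &
      exists c, forall u, (forall i, i < l -> u i < t) -> fixes t u ->
        pull chi w u = c].
Proof.
case: t => // t _; elim: t l T => [|t IH] l T tl.
  exists l => // chi cl; exists id; split=> //; first exact: rigid_id.
  exists (chi (fun=> 0)) => u ub _; apply: cl => i /ub /=; lia.
case: l tl => // l tl.
have [n ln Hn] := IH l T tl.
pose P p L (chi : (nat -> nat) -> T) := insensitive t.+1 p L chi.
pose Q p (v : nat -> nat) := forall i, t.+1 < v i < p -> v i = i.
have [|||N nN HN] := @fusion T t.+2 P Q n.+1 n.+1.
- by move=> p L tp pL; apply: insensitive_step.
- move=> p q N L chi v tq qp Pq [vb _ _] fv Qv a b ab fa eab aq bq.
  apply: Pq => [i /vb/ab //|i it|i iN iq||] /=.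
  + by rewrite fv ?fa //; lia.
  + apply: eab; first exact: vb.
    by apply: contra_neq iq => vi; rewrite -vi Qv // vi tq.
  + by rewrite fv.
  + by rewrite fv.
- by [].
exists N => [|chi cl]; first by lia.
have [w1 [r1 f1 Hw1]] := HN chi cl.
have cl1 : local n.+1 (pull chi w1) by apply: local_pull cl _; case: r1.
(* From words over the alphabet of size [t.+1] to words over the larger one: the
   new letter [t.+1] gets a position of its own behind the old letters, so that
   all later positions are shifted by one. [w2] is [w0] under the same shift. *)
pose lift (u : nat -> nat) i := if i <= t.+1 then i else u i.-1.
have cl2 : local n (pull chi w1 \o lift).
  move=> u v uv; apply: cl1 => i iN; rewrite /lift; case: (leqP i t.+1) => // ti.
  by apply: uv; lia.
have [w0 [[b0 s0 g0] f0 [c Hc]]] := Hn _ cl2.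
pose w2 i := if i <= t.+1 then i else if w0 i.-1 <= t then w0 i.-1 else (w0 i.-1).+1.
have wE i : i <= t.+1 -> w2 i = i by rewrite /w2 => ->.
have wS i : t < i -> t < w0 i -> w2 i.+1 = (w0 i).+1.
  by rewrite /w2; do !case: ifP => /=; lia.
exists (w2 \o w1); split.
- apply: rigid_comp r1; split=> [i iN|y yl|i y iN yw].
  + by rewrite /w2; have := b0 i.-1; do !case: ifP; lia.
  + have [yt|ty] := leqP y t.+1; first by exists y; [lia|exact: wE].
    have [|i iN wi] := s0 y.-1; first by lia.
    have [it|ti] := leqP i t; first by have := f0 i it; lia.
    by exists i.+1; rewrite ?wS //; lia.
  + have [yt|ty] := leqP y t.+1.
      by exists y; [move: yw; rewrite /w2; do !case: ifP; lia|exact: wE].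
    have ti : t.+1 < i by move: yw; rewrite /w2; case: ifP; lia.
    have tw : y.-1 < w0 i.-1.
      by move: yw; rewrite /w2; do !case: ifP; lia.
    have [|j ji wj] := g0 i.-1 _ _ tw; first by lia.
    have [jt|tj] := leqP j t; first by have := f0 j jt; lia.
    by exists j.+1; rewrite ?wS //; lia.
- by apply: fixes_comp f1 => i /wE.
exists c => u ub fu.
have -> : pull chi (w2 \o w1) u = pull chi w1 (u \o w2) by [].
rewrite (insensitive_collapse _ cl1 Hw1) //; first last.
- by move=> i it /=; rewrite wE ?fu.
- move=> i iN /=; rewrite -ltnS; apply: ub.
  by rewrite /w2; have := b0 i.-1; do !case: ifP; lia.
pose u0 i := if i <= t then i else minn (u i.+1) t.
rewrite -(Hc u0).
- apply: cl1 => i iN; rewrite /lift /=; case: (leqP i t.+1) => // ti.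
  rewrite /w2 leqNgt ti /= /u0; case: (leqP (w0 i.-1) t) => // wt.
  by rewrite fu ?ltnS; lia.
- by move=> i il; rewrite /u0; case: ifP; lia.
- by move=> i it; rewrite /u0 -ltnS it.
Qed.

(** * The dual Ramsey theorem *)

Definition cut m p (u : nat -> nat) (i : nat) : nat := if i < p then u i else m.

(** In a rigid surjection the first occurrence of a letter comes before
    all larger letters, whence the bound on the prefix. *)
Definition first_at m p (u : nat -> nat) : Prop :=
  u p = m /\ forall i, i < p -> u i < m.

Definition prefix_determined T m p L (chi : (nat -> nat) -> T) : Prop :=
  forall u u', rigid L m.+1 u -> rigid L m.+1 u' ->
    first_at m p u -> first_at m p u' -> (forall i, i < p -> u i = u' i) ->
    chi u = chi u'.

(** The part of a word [u] behind its first letter [m] is written as a word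
    over the alphabet of all positions up to [p], each letter of [u] being
    replaced by the position of its first occurrence. The Hales-Jewett theorem
    for this alphabet of [p.+1] letters makes the colour independent of that
    part, for all prefixes of length [p] at the same time. *)
Lemma prefix_determined_step (T : finType) m p L : p < L ->
  exists2 N, L <= N & forall chi : (nat -> nat) -> T, local N chi ->
    exists v, [/\ rigid N L v, fixes p v &
      prefix_determined m p L (pull chi v)].
Proof.
move=> pL.
pose K := {ffun {ffun 'I_p -> 'I_m.+1} -> T}.
have [N LN HN] := @hales_jewett p.+1 L K (ltn0Sn p) pL.
exists N => // chi cl.
pose chiK s : K := [ffun x => chi (extend x \o s)].
have clK : local N chiK.
  by move=> u v uv; apply/ffunP=> x; rewrite !ffunE; apply: cl => i /uv /= ->.
have [v [rv fv [c Hc]]] := HN _ clK; have [vb _ _] := rv.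
exists v; split=> //; first by apply: fixes_le fv.
move=> u1 u2 ru1 ru2 fu1 fu2 u12.
have [x xE] : exists x : {ffun 'I_p -> 'I_m.+1}, extend x =1 cut m p u1.
  apply: extend_restrict => i ip; case: ru1 => + _ _; apply; lia.
suff H u : rigid L m.+1 u -> first_at m p u -> extend x =1 cut m p u ->
    pull chi v u = c x.
  rewrite !H // => i; rewrite xE /cut; case: ifP => // ip; exact: u12.
move=> [ub us ur] [up uf] {}xE.
(* [u] is the composition of its prefix with [s]. *)
pose s i := if i <= p then i else index (u i) (mkseq u p.+1).
have sb i : i < L -> s i < p.+1.
  move=> iL; rewrite /s; case: (leqP i p) => // pi.
  have: index (u i) (mkseq u p.+1) < size (mkseq u p.+1).
    rewrite index_mem; apply/mapP.
    have [|um] := ltnP (u i) m.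
      rewrite -up => /ur[//|j jp uj]; exists j; rewrite ?uj //.
      by rewrite mem_iota; lia.
    by exists p; [rewrite mem_iota; lia|have := ub i iL; lia].
  by rewrite size_mkseq.
have su i : i < L -> cut m p u (s i) = u i.
  move=> iL; have := sb i iL; rewrite ltnS => sp.
  have -> : cut m p u (s i) = u (s i).
    by rewrite /cut; case: (ltnP (s i) p) => // ps; rewrite -up; congr u; lia.
  move: (sp) (sb i iL); rewrite /s; case: (leqP i p) => // pi _ sb'.
  rewrite -[u (index _ _)](nth_mkseq 0 u sb') nth_index //.
  by rewrite -index_mem size_mkseq.
rewrite -(Hc s sb); last by move=> i; rewrite ltnS /s => ->.
by rewrite /pull ffunE; apply: cl => i iN; rewrite /= xE su //; apply: vb.
Qed.

Lemma prefix_determined_all (T : finType) m L :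
  exists2 N, L <= N & forall chi : (nat -> nat) -> T, local N chi ->
    exists2 w, rigid N L w &
      forall p, p < L -> prefix_determined m p L (pull chi w).
Proof.
pose P p L (chi : (nat -> nat) -> T) := prefix_determined m p L chi.
have [p M _ pM|p q N M chi v _ qp Pq rv fv _||N LN HN] := @fusion T 0 P
  (fun _ _ => True) L L.
- have [N MN HN] := prefix_determined_step T m pM.
  exists N => // chi /HN[v [rv fv Pv]]; by exists v.
- move=> u u' ru ru' [uq uf] [uq' uf'] uu'; apply: Pq.
  + exact: rigid_comp rv.
  + exact: rigid_comp rv.
  + by split=> [|i iq] /=; rewrite fv ?uf //; lia.
  + by split=> [|i iq] /=; rewrite fv ?uf' //; lia.
  + by move=> i iq /=; rewrite fv ?uu' //; lia.
- by [].
by exists N => // chi /HN[w [rw _ Hw]]; exists w => // p pL; exact: Hw.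
Qed.

Definition dual_Ramsey m : Prop := forall l (T : finType),
  exists2 n, l <= n & forall chi : (nat -> nat) -> T, local n chi ->
    exists2 w, rigid n l w &
      exists c, forall u, rigid l m u -> pull chi w u = c.

(** With the dual Ramsey theorem for [m] letters, the colour of a prefix, which
    is a rigid surjection onto [m], can be made to depend only on the letter [p]
    of [w] at which it stops. The last letter is treated first: its prefix is
    the longest, and the words for the other letters are then found inside the
    subspace chosen for it. *)
Lemma uniform_prefixes m (T : finType) l : dual_Ramsey m ->
  exists2 N, l <= N &
  forall c : nat -> (nat -> nat) -> T, (forall q, local q (c q)) ->
    exists2 w, rigid N l w &
    exists e : nat -> T, forall p, p < l -> exists q,
      [/\ q < N, first_at p q w &
          forall u, rigid p m u -> pull (c q) w u = e p].
Proof.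
move=> DR; elim: l => [|l [N lN IH]].
  by exists 0 => // c _; exists id; [exact: rigid_id|exists (fun=> c 0 id)].
have [M NM HM] := DR N T.
exists M.+1 => [|c cl]; first by lia.
have [W rW [e0 HW]] := HM _ (cl M); have [Wb Ws Wr] := rW.
pose first q := index q (mkseq W M).
have firstP q i : i < first q -> i < M /\ W i < q.
  move=> iq; have iM : i < M.
    by apply: leq_trans iq _; rewrite -[X in _ <= X](size_mkseq W) index_size.
  split=> //; have := before_find 0 iq; rewrite nth_mkseq //= => Wq.
  case: ltngtP => // [qW|/eqP]; last by rewrite Wq.
  have [j ji Wj] := Wr i q iM qW.
  have := before_find 0 (ltn_trans ji iq).
  by rewrite nth_mkseq ?(ltn_trans ji) //= Wj eqxx.
have firstK q : q < N -> first q < M /\ W (first q) = q.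
  move=> /Ws[i iM Wi]; have qW : q \in mkseq W M.
    by rewrite -Wi; apply/mapP; exists i; rewrite ?mem_iota.
  have qM : first q < M by rewrite -[X in _ < X](size_mkseq W) index_mem.
  by split=> //; rewrite -[LHS](nth_mkseq 0 W qM) nth_index.
have [|w rw [e He]] := IH (fun q => pull (c (first q)) W).
  by move=> q; apply: local_pull (cl _) _ => i /firstP[].
have [wb ws wr] := rw; have [xb xs xr] := rigid_comp rw rW.
exists (fun i => if i < M then w (W i) else l).
  split=> [i iM|y|i y iM].
  - by case: ifP => // /xb /=; lia.
  - rewrite ltnS leq_eqVlt => /predU1P[->|/xs[i iM <-]].
      by exists M; rewrite ?ltnn.
    by exists i; rewrite ?iM //; lia.
  - case: (ltnP i M) => [{}iM /(xr _ _ iM)[j ji <-]|Mi /xs[j jM <-]].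
      by exists j => //; rewrite (ltn_trans ji iM).
    by exists j; rewrite ?jM //; lia.
exists (fun p => if p < l then e p else e0) => p.
rewrite ltnS leq_eqVlt => /predU1P[->|pl].
  exists M; split=> // [|u ru].
    by rewrite /first_at ltnn; split=> // i iM; rewrite iM; apply: xb.
  rewrite ltnn -(HW _ (rigid_comp ru rw)); apply: cl => i iM /=.
  by rewrite iM.
have [q [qN [wq wf] Hq]] := He p pl.
have [qM Wq] := firstK q qN.
exists (first q); split=> [||u ru]; first by lia.
  split=> [|i iq]; first by rewrite qM Wq.
  by have [-> /wf] := firstP _ _ iq.
by rewrite pl -(Hq u ru); apply: cl => i /firstP[iM _] /=; rewrite iM.
Qed.

(** By the pigeonhole principle many positive positions have the same colour [c].
    The first [l.-1] of them receive the letters [1, ..., l.-1] in this order, and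
    all other positions receive [0]. *)
Lemma uniform_letters (T : finType) l : 0 < l ->
  exists2 N, l <= N & forall e : nat -> T, exists2 w, rigid N l w &
    exists c, forall p q, 0 < p -> w q = p -> e q = c.
Proof.
move=> l0; exists (#|T| * l + l).+1 => [|e]; first by lia.
set N := _.+1.
pose S c q := (0 < q) && (e q == c).
have [c lc] : exists c, l <= count (S c) (iota 0 N).
  apply/existsP; apply: contraT; rewrite negb_exists => /forallP cl.
  have: \sum_(c : T) count (S c) (iota 0 N) <= \sum_(c : T) l.
    by apply: leq_sum => c _; have := cl c; lia.
  rewrite sum_nat_const.
  suff -> : \sum_(c : T) count (S c) (iota 0 N) = #|T| * l + l.
    by rewrite -[X in _ <= X]addn0 leq_add2l; lia.
  have -> : \sum_(c : T) count (S c) (iota 0 N) = count [pred q | 0 < q] (iota 0 N).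
    elim: (iota 0 N) => [|q s IH]; first by rewrite big1.
    rewrite /= big_split IH /=; congr (_ + _).
    rewrite /S; case: (0 < q) => /=; last by rewrite big1.
    by rewrite (bigD1 (e q)) //= eqxx big1 // => c /negbTE; rewrite eq_sym => ->.
  have -> : iota 0 N = 0 :: iota 1 (#|T| * l + l) by [].
  rewrite /= add0n; apply/eqP; rewrite -[X in _ == X](size_iota 1).
  by rewrite -all_count; apply/allP => q; rewrite mem_iota; case/andP.
pose rank q := count (S c) (iota 0 q).
have rankS q : rank q.+1 = rank q + S c q.
  by rewrite /rank -addn1 iotaD count_cat /= add0n addn0.
have rank_onto y q : y < rank q -> exists2 j, j < q & S c j /\ rank j = y.
  elim: q => [//|q IH]; rewrite rankS => yq.
  have [/IH[j jq Hj]|qy] := ltnP y (rank q); first by exists j => //; lia.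
  by exists q => //; move: yq; case: (S c q) => /=; split=> //; lia.
pose w q := if S c q && ((rank q).+1 < l) then (rank q).+1 else 0.
have wpos y q : 0 < y -> y < l -> y.-1 < rank q -> exists2 j, j < q & w j = y.
  move=> y0 yl /rank_onto[j jq [Sj rj]]; exists j => //.
  by rewrite /w Sj rj ifT; lia.
have w0 : w 0 = 0 by [].
exists w; last first.
  exists c => p q p0 wq; move: p0; rewrite -wq /w; case: ifP => // /andP[+ _] _.
  by case/andP=> _ /eqP.
split=> [i _|y yl|i y _].
- by rewrite /w; case: ifP => // /andP[].
- case: y yl => [|y] yl; first by exists 0.
  by apply: wpos => //=; apply: leq_trans lc; lia.
- rewrite /w; case: ifP => // /andP[/andP[i0 _] ril] yi.
  case: y yi => [|y] yi; first by exists 0.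
  by apply: wpos => //=; lia.
Qed.

Lemma rigid_cut m L q u : q < L -> rigid L m.+1 u -> first_at m q u ->
  rigid L m.+1 (cut m q u).
Proof.
move=> qL [ub us ur] [uq uf]; split=> [i iL|y ym|i y iL].
- by rewrite /cut; case: ifP => // _; apply: ub.
- have [ym'|my] := ltnP y m; last by exists q; rewrite ?/cut ?ltnn; lia.
  have := ym'; rewrite -uq => /(ur _ _ qL)[j jq uj].
  by exists j; rewrite /cut ?jq //; apply: ltn_trans jq qL.
- rewrite /cut; case: (ltnP i q) => [iq /(ur _ _ iL)[j ji <-]|qi].
    by exists j; rewrite // (ltn_trans ji iq).
  rewrite -{1}uq => /(ur _ _ qL)[j jq <-].
  by exists j; rewrite ?jq //; lia.
Qed.

(** Induction on the number [m] of letters. A rigid surjection onto [m.+1] has a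
    prefix up to the first occurrence of the last letter. The colour is made to
    depend on this prefix alone, then only on the place where it stops, and
    finally not even on this place. *)
Theorem dual_Ramsey_theorem m : 0 < m -> dual_Ramsey m.
Proof.
case: m => // m _; elim: m => [|m IH] l T.
  exists l => // chi cl; exists id; first exact: rigid_id.
  exists (chi (fun=> 0)) => u [ub _ _]; apply: cl => i /ub /=; lia.
have [->|l0] := posnP l.
  exists 0 => // chi _; exists id; first exact: rigid_id.
  by exists (chi id) => u [_ /(_ 0)[]].
have [l3 ll3 H3] := uniform_letters T l0.
have [l2 ll2 H2] := uniform_prefixes T l3 IH.
have [n ln Hn] := prefix_determined_all T m.+1 l2.
exists n => [|chi cl]; first by lia.
have [w1 r1 det] := Hn chi cl; set chi1 := pull chi w1 in det.
have cl1 : local l2 chi1 by apply: local_pull cl _; case: r1.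
have [|w2 r2 [e He]] := H2 (fun q u => chi1 (cut m.+1 q u)).
  by move=> q u v uv; apply: cl1 => i _; rewrite /cut; case: ifP => // /uv.
have [w3 r3 [c Hc]] := H3 e.
exists (w3 \o (w2 \o w1)); first exact: rigid_comp r3 (rigid_comp r2 r1).
exists c => u ru.
have ru32 := rigid_comp (rigid_comp ru r3) r2.
have [p [pl up pf]] := rigid_first ru (ltnSn _).
have p0 : 0 < p.
  by rewrite lt0n; apply/eqP => p0; have := rigid0 ru l0; rewrite -{1}p0 up.
have [q3 [q3l w3q f3]] := rigid_first r3 pl.
have [q2 [q2l [w2q f2] Hq2]] := He q3 q3l.
have fu : first_at m.+1 q2 ((u \o w3) \o w2).
  by split=> [|i iq2] /=; rewrite ?w2q ?w3q // pf // f3 // f2.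
have -> : pull chi (w3 \o (w2 \o w1)) u = chi1 ((u \o w3) \o w2) by [].
rewrite (det q2 q2l _ _ ru32 (rigid_cut q2l ru32 fu)) //; first last.
- by move=> i iq; rewrite /cut iq.
- by split=> [|i iq]; rewrite /cut ?ltnn // iq; apply: (proj2 fu).
have ru3 : rigid q3 m.+1 (u \o w3).
  apply: (@rigid_comp _ p).
    by rewrite -up; apply: rigid_prefix ru pl _ => i /pf; rewrite up.
  by rewrite -w3q; apply: rigid_prefix r3 q3l _ => i /f3; rewrite w3q.
by rewrite -[LHS]/(pull (fun u => chi1 (cut m.+1 q2 u)) w2 (u \o w3)) Hq2 // (Hc p).
Qed.

(** * Lexicographic orders *)

Lemma linear_order_min (T : finType) (lt : rel T) (P : pred T) x0 :
  strict_linear_order lt -> P x0 ->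
  exists2 x, P x & forall y, lt y x -> ~~ P y.
Proof.
move=> [irr tr _] Px0.
case: (arg_minnP (fun x => #|[pred y | lt y x]|) Px0) => x Px xmin.
exists x => // y yx; apply/negP => /xmin; apply/negP; rewrite -ltnNge.
apply: proper_card; apply/properP; split.
  by apply/subsetP=> z; rewrite !inE => /tr; apply.
by exists y; rewrite !inE ?irr.
Qed.

(** Lexicographic order of characteristic functions, [lt]-small elements being
    the most significant ones. *)
Definition lex (T : finType) (lt : rel T) (U V : {set T}) : bool :=
  [exists c, [&& c \in V, c \notin U &
    [forall d, lt d c ==> ((d \in U) == (d \in V))]]].

Lemma lexP (T : finType) (lt : rel T) (U V : {set T}) :
  reflect (exists c, [/\ c \in V, c \notin U &
             forall d, lt d c -> (d \in U) = (d \in V)])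
          (lex lt U V).
Proof.
apply: (iffP existsP) => -[c].
  case/and3P=> cV cU /forallP cd; exists c; split=> // d dc.
  by have := cd d; rewrite dc => /eqP.
move=> [cV cU cd]; exists c; rewrite cV cU; apply/forallP=> d.
by apply/implyP=> /cd->.
Qed.

Lemma first_difference (T : finType) (lt : rel T) (U V : {set T}) x :
  strict_linear_order lt -> (x \in U) != (x \in V) ->
  exists2 c, (c \in U) != (c \in V) &
    forall d, lt d c -> (d \in U) = (d \in V).
Proof.
move=> slo xUV; pose P c := (c \in U) != (c \in V).
have [c Pc cmin] := @linear_order_min T lt P x slo xUV.
by exists c => // d /cmin; rewrite negbK => /eqP.
Qed.

Lemma lex_linear (T : finType) (lt : rel T) :
  strict_linear_order lt -> strict_linear_order (lex lt).
Proof.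
move=> slo; have [irr tr tot] := slo; split=> [U|V U W|U V UV].
- by apply/lexP=> -[c [-> ]].
- move=> /lexP[c [cV cU Hc]] /lexP[d [dW dV Hd]]; apply/lexP.
  have cd : c <> d by move=> cd; rewrite cd (negPf dV) in cV.
  have [cd'|dc] := tot _ _ cd.
    exists c; rewrite -Hd //; split=> // e ec.
    by rewrite Hc // Hd //; apply: tr cd'.
  exists d; rewrite Hc //; split=> // e ed.
  by rewrite Hc ?Hd //; apply: tr dc.
- have [c cUV] : exists c, (c \in U) != (c \in V).
    apply/existsP; apply: contraPT UV; rewrite negb_exists => /forallP UV.
    by apply; apply/setP=> c; apply/eqP; have := UV c; rewrite negbK.
  have [d dUV Hd] := first_difference slo cUV.
  case dU: (d \in U) dUV => dV; [right|left]; apply/lexP; exists d.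
    by split=> [||e /Hd].
  by split=> //; [case: (d \in V) dV|rewrite dU].
Qed.

(** The form in which lexicographic comparisons are established below: it is enough
    that no element of [U] outside [V] can be the first difference. *)
Lemma lex_intro (T : finType) (lt : rel T) (U V : {set T}) x :
  strict_linear_order lt -> x \in V -> x \notin U ->
  (forall y, y \in U -> y \notin V ->
     exists z, [/\ z \in V, z \notin U & lt z y]) ->
  lex lt U V.
Proof.
move=> slo xV xU H.
have [|c cUV Hc] := @first_difference _ _ U V x slo; first by rewrite xV (negPf xU).
case cU: (c \in U) cUV => cV; last first.
  by apply/lexP; exists c; split=> //; [case: (c \in V) cV|rewrite cU].
have [z [zV zU /Hc zUV]] := H c cU cV.
by rewrite zUV zV in zU.
Qed.

Lemma ltn_linear n : strict_linear_order (fun i j : 'I_n => i < j).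
Proof.
split=> [i|j i k|i j ij]; rewrite ?ltnn //; first exact: ltn_trans.
by have [||/val_inj] := ltngtP i j; [left|right|].
Qed.

(** * Ordered posets and cubes *)

(** Linear orders are reflected as soon as they are preserved, and injectivity
    comes for free. *)
Lemma embedding_intro (A B : ostruct) (f : A -> B) :
  strict_linear_order (@prec A) -> strict_linear_order (@prec B) ->
  (forall x y, sq (f x) (f y) = sq x y) ->
  (forall x y, prec x y -> prec (f x) (f y)) -> embedding f.
Proof.
move=> [irrA trA totA] [irrB trB _] fsq fpr; split=> //.
  move=> x y fxy; apply/eqP; apply: contraT => /eqP/totA.
  by case=> /fpr; rewrite fxy irrB.
move=> x y; apply/idP/idP=> [fxy|/fpr //].
have [xy|/eqP/totA[//|/fpr fyx]] := eqVneq x y.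
  by rewrite xy irrB in fxy.
by have := trB _ _ _ fxy fyx; rewrite irrB.
Qed.

Definition ordered_poset (A : ostruct) : Prop :=
  [/\ reflexive (@sq A), antisymmetric (@sq A), transitive (@sq A),
      strict_linear_order (@prec A)
    & forall a b : A, sq a b -> a <> b -> prec a b].

Definition cube_poset (n : nat) : fstruct :=
  @FStruct {set 'I_n} (fun U V => U \subset V).

Definition cube (n : nat) : ostruct :=
  @OStruct (cube_poset n) (lex (fun i j : 'I_n => i < j)).

Lemma cube_ordered_poset n : ordered_poset (cube n).
Proof.
have slo : strict_linear_order (@prec (cube n)).
  exact: lex_linear (@ltn_linear n).
split=> //=.
- by move=> U V /andP[UV VU]; apply/eqP; rewrite eqEsubset UV.
- by move=> V U W; apply: subset_trans.
have [_ _ tot] := slo; move=> U V UV /tot[// | /lexP[c [cU cV _]]].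
by rewrite (subsetP UV) in cV.
Qed.

(** * Ramsey theorem for ordered posets *)

Definition upsets (A : fstruct) : {set {set A}} :=
  [set U : {set A} | [forall a, forall b, (a \in U) && sq a b ==> (b \in U)]].

Lemma upsetP (A : fstruct) (U : {set A}) :
  reflect (forall a b, a \in U -> sq a b -> b \in U) (U \in upsets A).
Proof.
rewrite inE; apply: (iffP forallP) => H a.
  by move=> b aU ab; have /forallP/(_ b) := H a; rewrite aU ab.
by apply/forallP=> b; apply/implyP=> /andP[]; apply: H.
Qed.

Definition up_closure (A : fstruct) (U : {set A}) : {set A} :=
  [set b | [exists a in U, sq a b]].

Lemma up_closureP (A : fstruct) (U : {set A}) b :
  reflect (exists2 a, a \in U & sq a b) (b \in up_closure U).
Proof. by rewrite inE; apply: exists_inP. Qed.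

Lemma up_closure_upset (A : ostruct) (U : {set A}) :
  ordered_poset A -> up_closure U \in upsets A.
Proof.
move=> [_ _ tr _ _]; apply/upsetP=> a b /up_closureP[c cU ca] ab.
by apply/up_closureP; exists c => //; apply: tr ab.
Qed.

Definition enumerates (X : finType) (S : {set X}) (lt : rel X) (m : nat)
    (letter : nat -> X) (rank : X -> nat) : Prop :=
  [/\ forall y, y < m -> letter y \in S,
      forall x, x \in S -> rank x < m,
      forall x, x \in S -> letter (rank x) = x,
      forall y, y < m -> rank (letter y) = y
    & forall y z, y < z -> z < m -> lt (letter y) (letter z)].

Lemma enumerate (X : finType) (S : {set X}) (lt : rel X) (x0 : X) :
  strict_linear_order lt -> exists letter rank, enumerates S lt #|S| letter rank.
Proof.
move=> [irr tr tot].
pose le x y := (x == y) || lt x y.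
have letr : transitive le.
  move=> y x z /predU1P[-> //|xy] /predU1P[<-|yz]; first by rewrite /le xy orbT.
  by rewrite /le (tr _ _ _ xy yz) orbT.
have letot : total le.
  by move=> x y; rewrite /le; have [//|/eqP/tot[] ->] := eqVneq x y; rewrite ?orbT.
pose s := sort le (enum S).
have ss : size s = #|S| by rewrite size_sort cardE.
have us : uniq s by rewrite sort_uniq enum_uniq.
have ms x : (x \in s) = (x \in S) by rewrite mem_sort mem_enum.
have srt : sorted le s by apply: sort_sorted.
exists (nth x0 s), (index^~ s); split=> [y ym|x xS|x xS|y ym|y z yz zm].
- by rewrite -ms mem_nth ?ss.
- by rewrite -ss index_mem ms.
- by rewrite nth_index ?ms.
- by rewrite index_uniq ?ss.
have := sorted_ltn_nth letr x0 srt; move=> /(_ y z).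
rewrite !inE ss zm (ltn_trans yz zm) => /(_ isT isT yz) /orP[|//].
by rewrite nth_uniq ?ss // ?(ltn_trans yz zm) // ltn_eqF.
Qed.

Lemma enumerates_lt (X : finType) (S : {set X}) lt m letter rank x y :
  strict_linear_order lt -> enumerates S lt m letter rank ->
  x \in S -> y \in S -> lt x y -> rank x < rank y.
Proof.
move=> [irr tr _] [_ rm rK _ inc] xS yS xy.
case: ltngtP => // [yx|exy].
  have := inc _ _ yx (rm _ xS); rewrite !rK // => yx'.
  by have := tr _ _ _ xy yx'; rewrite irr.
by have := irr x; rewrite -{2}(rK _ xS) exy rK // xy.
Qed.

(** The letters for an ordered poset are its upsets. In a monotone map from [A] to
    a power set, the elements of [A] whose image contains a given point form
    an upset, so that such a map is a word over this alphabet. *)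
Definition alphabet (A : ostruct) :=
  enumerates (upsets A) (lex (@prec A)) #|upsets A|.

Lemma alphabet_exists (A : ostruct) : ordered_poset A ->
  exists letter rank, @alphabet A letter rank.
Proof. by move=> [_ _ _ slo _]; apply: enumerate set0 (lex_linear slo). Qed.

Definition word_map (A : ostruct) (letter : nat -> {set A}) n (u : nat -> nat)
  (a : A) : cube n := [set i : 'I_n | a \in letter (u i)].

(** Inclusion is reflected because every principal upset occurs as a letter. If
    [a] precedes [b], then any upset that contains [a] but not [b] comes after
    the upset generated by [b]; by rigidity the latter occurs earlier in [u], and
    hence the first place where the images differ belongs to that of [b]. *)
Lemma word_map_embedding (A : ostruct) letter rank n u :
  ordered_poset A -> @alphabet A letter rank -> rigid n #|upsets A| u ->
  embedding (@word_map A letter n u).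
Proof.
move=> pA alph [ub us ur]; have [lS rm rK lK _] := alph.
have [re an tr slo ext] := pA; have [irr trp tot] := slo.
pose up (a : A) : {set A} := up_closure [set a].
have upE (a b : A) : (b \in up a) = sq a b.
  apply/up_closureP/idP => [[c]|ab]; first by rewrite inE => /eqP->.
  by exists a; rewrite ?inE.
have upS (a : A) : up a \in upsets A by apply: up_closure_upset.
have [_ _ _ slo_cube _] := cube_ordered_poset n.
apply: embedding_intro => // a b.
  apply/subsetP/idP => [ab|ab i]; last first.
    by rewrite !inE => /(upsetP _ (lS _ (ub _ (ltn_ord i)))); apply.
  have [i iN ui] := us _ (rm _ (upS a)).
  have := ab (Ordinal iN); rewrite !inE /= ui rK // !upE; apply; exact: re.
move=> ab.
have prec_le (c d e : A) : prec c d -> sq d e -> prec c e.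
  move=> cd de; have [<- //|/eqP/(ext _ _ de)] := eqVneq d e.
  exact: trp cd.
have nba : sq b a = false.
  by apply/negP=> /(prec_le _ _ _ ab); rewrite irr.
have [ib ibN uib] := us _ (rm _ (upS b)).
apply: (@lex_intro _ _ _ _ (Ordinal ibN)); first exact: ltn_linear.
- by rewrite inE /= uib rK // upE re.
- by rewrite inE /= uib rK // upE nba.
move=> i; rewrite !inE => aI bI.
have lt_up : lex (@prec A) (up b) (letter (u i)).
  apply: (lex_intro slo aI); rewrite ?upE ?nba // => c; rewrite upE => bc _.
  by exists a; rewrite upE nba (prec_le _ _ _ ab bc).
have := enumerates_lt (lex_linear slo) alph (upS b) (lS _ (ub _ (ltn_ord i))) lt_up.
rewrite lK ?ub // => /(ur _ _ (ltn_ord i))[j ji uj].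
exists (Ordinal (ltn_trans ji (ltn_ord i))).
by rewrite !inE /= uj rK // !upE nba re ji.
Qed.

(** An embedding [g] of [A] into [B] acts on letters by inverse images. This
    action is a rigid surjection: an upset of [A] is the inverse image of the
    upset generated by its image, and this is the first letter of the alphabet
    of [B] with that inverse image. *)
Lemma word_map_comp (A B : ostruct) lA rA lB rB (g : A -> B) :
  ordered_poset A -> ordered_poset B ->
  @alphabet A lA rA -> @alphabet B lB rB -> embedding g ->
  exists2 u, rigid #|upsets B| #|upsets A| u &
    forall n w a, rigid n #|upsets B| w ->
      word_map lB n w (g a) = word_map lA n (u \o w) a :> {set 'I_n}.
Proof.
move=> pA pB aA aB [ginj gsq gpr].
have [lAS rAm rAK lAK _] := aA; have [lBS rBm rBK lBK _] := aB.
have [reA _ _ sloA _] := pA; have [reB _ trB sloB extB] := pB.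
have preS y : y < #|upsets B| -> g @^-1: lB y \in upsets A.
  move=> ym; apply/upsetP=> a b; rewrite !inE -(gsq a b).
  exact: (upsetP _ (lBS _ ym)).
pose up (U : {set A}) := up_closure (g @: U).
have upS U : up U \in upsets B by apply: up_closure_upset.
have upK U : U \in upsets A -> g @^-1: up U = U.
  move=> US; apply/setP=> a; rewrite inE; apply/up_closureP/idP.
    by move=> [_ /imsetP[b bU ->]]; rewrite gsq; apply: (upsetP _ US).
  by move=> aU; exists (g a); [exact: imset_f|exact: reB].
exists (fun y => rA (g @^-1: lB y)).
  split=> [y ym|y ym|y z ym zy].
  - exact: rAm (preS _ ym).
  - by exists (rB (up (lA y))); rewrite ?rBm ?rBK ?upK ?lAK ?lAS.
  have zm : z < #|upsets A| by apply: ltn_trans zy (rAm _ (preS _ ym)).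
  exists (rB (up (lA z))); last by rewrite rBK ?upK ?lAK ?lAS.
  rewrite -[X in _ < X](lBK _ ym).
  apply: (enumerates_lt (lex_linear sloB) aB) => //; first exact: lBS.
  have /lexP[c [cU cV Hc]] : lex (@prec A) (lA z) (g @^-1: lB y).
    have [_ _ _ _ inc] := aA.
    by have := inc _ _ zy (rAm _ (preS _ ym)); rewrite rAK // preS.
  rewrite inE in cU.
  apply: (lex_intro sloB cU).
    by apply: contra cV => cup; rewrite -(upK _ (lAS _ zm)) inE.
  move=> d /up_closureP[_ /imsetP[e eU ->] ged] dV.
  exists (g c); split=> //.
    by apply: contra cV => cup; rewrite -(upK _ (lAS _ zm)) inE.
  have ec : e <> c by move=> ec; rewrite -ec eU in cV.
  have ne : ~~ prec e c.
    apply/negP=> /Hc; rewrite eU inE => eB.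
    by rewrite (upsetP _ (lBS _ ym) _ _ (esym eB) ged) in dV.
  have [_ _ totA] := sloA; have [_ trpB _] := sloB.
  have gce : prec (g c) (g e) by rewrite gpr; case: (totA _ _ ec) ne => ->.
  have [<- //|/eqP/(extB _ _ ged)] := eqVneq (g e) d.
  exact: trpB gce.
move=> n w a [wb _ _]; apply/setP=> i; rewrite !inE /=.
by rewrite (rAK _ (preS _ (wb _ (ltn_ord i)))) inE.
Qed.

(** By [word_map_comp] the copies of [A] inside a word map of [B] are the word
    maps of the compositions [u \o w] with [u] rigid, which is what the dual
    Ramsey theorem makes monochromatic. *)
Theorem ordered_poset_Ramsey (A B : ostruct) (T : finType) :
  ordered_poset A -> ordered_poset B ->
  exists n, forall chi : {set cube n} -> T,
    exists2 h : B -> cube n, embedding h &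
    exists c, forall g : A -> B, embedding g -> chi [set h (g a) | a : A] = c.
Proof.
move=> pA pB.
have [lA [rA aA]] := alphabet_exists pA; have [lB [rB aB]] := alphabet_exists pB.
have upA0 : 0 < #|upsets A|.
  by apply/card_gt0P; exists set0; apply/upsetP=> a b; rewrite inE.
have [n _ Hn] := dual_Ramsey_theorem upA0 #|upsets B| T.
exists n => chi.
pose chiw u := chi [set word_map lA n u a | a : A].
have [|w rw [c Hc]] := Hn chiw.
  move=> u v uv; congr chi; apply: eq_imset => a; apply/setP=> i.
  by rewrite !inE uv.
exists (word_map lB n w); first exact: word_map_embedding pB aB rw.
exists c => g eg; have [u ru Hu] := word_map_comp pA pB aA aB eg.
rewrite -(Hc u ru); congr chi; apply: eq_imset => a; exact: Hu.
Qed.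

Lemma embedding_factor (A B C : ostruct) (f : B -> C) (g : A -> B) :
  embedding f -> embedding (f \o g) -> embedding g.
Proof.
move=> [fi fs fp] [gi gs gp]; split=> [|x y|x y].
- exact: inj_compr gi.
- by rewrite -fs; apply: gs.
- by rewrite -fp; apply: gp.
Qed.

Lemma copy_image (B C : ostruct) (h : B -> C) :
  embedding h -> copy B [set h b | b : B].
Proof.
move=> eh; have [hi hs hp] := eh; set X := [set h b | b : B].
have hX b : h b \in X by apply: imset_f.
pose g (b : B) : substructure X := exist _ (h b) (hX b).
have gi : injective g by move=> b b' /(congr1 val)/hi.
have [|f gK fK] := @inj_card_bij _ _ g gi.
  by rewrite card_sig card_imset.
exists f; last by exists g.
split=> [|x y|x y]; first exact: can_inj fK.
  by rewrite -hs -[in RHS](fK x) -[in RHS](fK y).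
by rewrite -hp -[in RHS](fK x) -[in RHS](fK y).
Qed.

Lemma copy_embedding (A C : ostruct) (Y : {set C}) : copy A Y ->
  exists2 f : A -> C, embedding f & Y = [set f a | a : A].
Proof.
move=> [f [fi fs fp] [g fK gK]]; exists (fun a => val (g a)).
  split=> [a b /val_inj/(can_inj gK) //|a b|a b].
    by rewrite -[in RHS](gK a) -[in RHS](gK b) fs.
  by rewrite -[in RHS](gK a) -[in RHS](gK b) fp.
apply/setP=> y; apply/idP/imsetP=> [yY|[a _ ->]]; last exact: valP.
by exists (f (exist _ y yY)); rewrite ?fK.
Qed.

Lemma cube_arrows (A B : ostruct) k : ordered_poset A -> ordered_poset B ->
  exists n, arrows (cube n) B A k.
Proof.
move=> pA pB; have [n Hn] := ordered_poset_Ramsey 'I_k pA pB.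
exists n => chi; have [h eh [c Hc]] := Hn chi.
exists [set h b | b : B]; first exact: copy_image.
exists c => Y /copy_embedding[f ef ->] sub.
have /fin_all_exists[g gP] a : exists b, f a = h b.
  by have /imsetP[b _ ->] := subsetP sub _ (imset_f f (erefl : a \in A)); exists b.
rewrite -(Hc g); first by congr chi; apply: eq_imset.
apply: (embedding_factor eh); case: ef => fi fs fp.
split=> [a b /=|a b /=|a b /=]; rewrite -!gP; [exact: fi|exact: fs|exact: fp].
Qed.

(** * Arbitrary linear extensions of cubes *)

Definition antichain2 : ostruct :=
  @OStruct (@FStruct bool eq_op) (fun x y => ~~ x && y).

(** The elements [0] and [2] are comparable and [1], incomparable to both, lies
    between them in the linear order. No linear extension reverses the linear
    order on all incomparable pairs, since it would put [2] below [0]. *)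
Definition twisted3 : ostruct :=
  @OStruct (@FStruct 'I_3 (fun i j => (i == j) || (i == 0 :> nat) && (j == 2 :> nat)))
           (fun i j => i < j).

Definition ordered_sum (A B : ostruct) : ostruct :=
  @OStruct (@FStruct (A + B)%type (fun x y => match x, y with
       | inl a, inl b => sq a b | inr a, inr b => sq a b | _, _ => false end))
    (fun x y => match x, y with
       | inl a, inl b => prec a b | inr a, inr b => prec a b
       | inl _, inr _ => true | inr _, inl _ => false end).

Lemma antichain2_ordered_poset : ordered_poset antichain2.
Proof.
split=> //=; first by move=> x y /andP[/eqP].
- by move=> y x z /eqP-> .
- by split=> [[]|[] [] []|[] []] //=; [right|left].
- by move=> a b /eqP.
Qed.

Lemma twisted3_ordered_poset : ordered_poset twisted3.
Proof.
split=> /=.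
- by move=> i; rewrite /= eqxx.
- by move=> i j /andP[/predU1P[//|/andP[_ /eqP j2]] /predU1P[//|]]; rewrite j2.
- move=> j i k /predU1P[-> //|/andP[i0 /eqP j2]] /predU1P[<-|].
    by rewrite i0 j2 orbT.
  by rewrite j2.
- exact: ltn_linear.
- by move=> i j /predU1P[//|/andP[/eqP-> /eqP->]].
Qed.

Lemma ordered_sum_ordered_poset A B :
  ordered_poset A -> ordered_poset B -> ordered_poset (ordered_sum A B).
Proof.
move=> [reA anA trA [irA tpA toA] exA] [reB anB trB [irB tpB toB] exB].
split=> /=.
- by case=> a /=; [apply: reA|apply: reB].
- by move=> [a|a] [b|b] //=; [move=> /anA->|move=> /anB->].
- by move=> [b|b] [a|a] [c|c] //=; [apply: trA|apply: trB].
- split=> [[a|a]|[b|b] [a|a] [c|c]|[a|a] [b|b] ab] //=.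
  + exact: tpA.
  + exact: tpB.
  + by apply: toA => ab'; apply: ab; rewrite ab'.
  + by left.
  + by right.
  + by apply: toB => ab'; apply: ab; rewrite ab'.
- move=> [a|a] [b|b] //= ab nab.
  + by apply: exA => // ab'; apply: nab; rewrite ab'.
  + by apply: exB => // ab'; apply: nab; rewrite ab'.
Qed.

Lemma antichain2_embedding (B : ostruct) (x y : B) :
  ordered_poset B -> prec x y -> ~~ sq x y ->
  @embedding antichain2 B (fun b => if b then y else x).
Proof.
move=> [re _ _ slo ext] xy nxy.
have nyx : ~~ sq y x.
  have [irr tr _] := slo; apply/negP=> /ext yx.
  have := tr _ _ _ xy (yx _); rewrite irr => F; suff: false by [].
  by apply: F => yx'; rewrite yx' irr in xy.
have [_ _ _ sloA _] := antichain2_ordered_poset.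
apply: embedding_intro => // -[] [] //=; rewrite ?re //; exact: negbTE.
Qed.

(** The two-element antichains of the cube are coloured according to whether [lt]
    agrees on them with the lexicographic order. On a monochromatic copy of the
    sum of [A] and [twisted3], either [lt] agrees with the given linear order, and
    [A] embeds, or it reverses all incomparable pairs, which [twisted3]
    rules out. *)
Lemma cube_all_linear_extensions (A : ostruct) : ordered_poset A ->
  exists n, forall lt : rel (cube_poset n),
    ordered_poset (OStruct lt) -> embeds A (OStruct lt).
Proof.
move=> pA; set B := ordered_sum A twisted3.
have pB : ordered_poset B.
  exact: ordered_sum_ordered_poset twisted3_ordered_poset.
have [n Hn] := ordered_poset_Ramsey bool antichain2_ordered_poset pB.
exists n => lt [_ _ _ sloL extL].
pose chi (Y : {set cube n}) :=
  [exists S in Y, exists S' in Y, @prec (cube n) S S' && lt S S'].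
have [h eh [c Hc]] := Hn chi; have [hi hs hp] := eh.
have [_ _ _ sloC _] := cube_ordered_poset n.
have chiE x y : prec x y -> ~~ sq x y -> lt (h x) (h y) = c.
  move=> xy nxy; rewrite -(Hc _ (antichain2_embedding pB xy nxy)).
  have [irr tr _] := sloC; have hxy : prec (h x) (h y) by rewrite hp.
  apply/idP/exists_inP => [ltxy|[_ /imsetP[b _ ->] /exists_inP[_ /imsetP[b' _ ->]]]].
    exists (h x); first by apply/imsetP; exists false.
    apply/exists_inP; exists (h y); first by apply/imsetP; exists true.
    by rewrite hxy.
  case: b b' => [] [] /andP[pS lS] //; try by rewrite irr in pS.
  by have := tr _ _ _ hxy pS; rewrite irr.
have ltE x y : prec x y -> sq x y -> lt (h x) (h y).
  move=> xy sxy; apply: extL; first by rewrite -hs in sxy.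
  by move=> /hi exy; have [_ _ _ [irr _ _] _] := pB; rewrite exy irr in xy.
case: c Hc chiE => Hc chiE.
  exists (fun a => h (inl a)); apply: embedding_intro => //.
  - by case: pA.
  - move=> x y xy; case sxy: (sq x y); first exact: (ltE (inl x) (inl y)).
    by apply: (chiE (inl x) (inl y)) => //=; rewrite sxy.
exfalso; have [irr tr tot] := sloL.
pose p (i : 'I_3) : B := inr i.
have rev i j : prec (p i) (p j) -> ~~ sq (p i) (p j) -> lt (h (p j)) (h (p i)).
  move=> ij sij; have nij := chiE _ _ ij sij.
  have [|ltij|//] := tot (h (p i)) (h (p j)); last by rewrite /= nij in ltij.
  by move=> /hi[eij]; rewrite eij /= ltnn in ij.
have l10 := rev (@Ordinal 3 0 isT) (@Ordinal 3 1 isT) isT isT.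
have l21 := rev (@Ordinal 3 1 isT) (@Ordinal 3 2 isT) isT isT.
have l02 := ltE (p (@Ordinal 3 0 isT)) (p (@Ordinal 3 2 isT)) isT isT.
by have := tr _ _ _ l02 (tr _ _ _ l21 l10); rewrite irr.
Qed.

(** The smaller cube sits in the larger one, and linear extensions restrict. *)
Lemma cube_widen (A : ostruct) n N : n <= N ->
  (forall lt : rel (cube_poset n),
    ordered_poset (OStruct lt) -> embeds A (OStruct lt)) ->
  forall lt : rel (cube_poset N),
    ordered_poset (OStruct lt) -> embeds A (OStruct lt).
Proof.
move=> nN Hn lt [_ _ _ [irr tr tot] ext].
pose i (U : cube_poset n) : cube_poset N := [set widen_ord nN x | x in U].
have wi : injective (widen_ord nN).
  by move=> x y /(congr1 (@nat_of_ord N)) xy; apply: val_inj.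
have ii : injective i by apply: imset_inj.
have is_ U V : sq (i U) (i V) = sq U V.
  apply/subsetP/subsetP => UV x xU.
    by have := UV _ (imset_f _ xU); rewrite mem_imset.
  by case/imsetP: xU => y /UV yV ->; apply: imset_f.
have [re an trs _ _] := cube_ordered_poset n.
have [|f [fi fs fp]] := Hn (fun U V => lt (i U) (i V)).
  split=> //.
    split=> [U|V U W|U V UV]; [exact: irr|exact: tr|].
    by apply: tot => /ii.
  by move=> U V UV nUV; apply: ext => [|/ii //]; rewrite is_.
exists (i \o f); split=> [|x y|x y] /=; first exact: inj_comp.
  by rewrite -fs; apply: is_.
exact: fp.
Qed.

(** * Varieties of lattices and semilattices *)

(** The only feature of the variety that matters: its finite members are posets
    and include all finite power sets. For the ordering property, the
    dimensions required by the finitely many linear extensions of [A] have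
    a common bound. *)
Lemma cube_classes O (meet : O) (V : algebra O -> Prop) :
  (forall S, rel_class meet V S ->
     [/\ reflexive (@sq S), antisymmetric (@sq S) & transitive (@sq S)]) ->
  (forall n, rel_class meet V (cube_poset n)) ->
  Ramsey_property (ordered_rel_class meet V) /\
  ordering_property (ordered_rel_class meet V).
Proof.
move=> poset_V cube_V.
have K_poset A : ordered_rel_class meet V A -> ordered_poset A.
  by move=> [/poset_V[re an tr] slo ext]; split.
have cube_K n : ordered_rel_class meet V (cube n).
  by have [_ _ _ slo ext] := cube_ordered_poset n; split=> //; apply: cube_V.
split=> [A B KA KB _ k _|A _].
  by have [n Hn] := cube_arrows k (K_poset _ KA) (K_poset _ KB); exists (cube n).
have /fin_all_exists[n Hn] (R : {ffun A * A -> bool}) : exists n,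
    ordered_poset (@OStruct A (fun a b => R (a, b))) ->
    forall lt : rel (cube_poset n), ordered_poset (OStruct lt) ->
      embeds (@OStruct A (fun a b => R (a, b))) (OStruct lt).
  have [pA|npA] := classic (ordered_poset (@OStruct A (fun a b => R (a, b)))).
    by have [n Hn] := cube_all_linear_extensions pA; exists n.
  by exists 0.
exists (cube_poset (\max_R n R)); first by exists (@prec (cube _)); apply: cube_K.
move=> ltA ltB /K_poset pA /K_poset pB.
pose R : {ffun A * A -> bool} := [ffun ab => ltA ab.1 ab.2].
have RE a b : R (a, b) = ltA a b by rewrite ffunE.
have pR : ordered_poset (@OStruct A (fun a b => R (a, b))).
  have [re an tr [irr trp tot] ext] := pA; split=> //=.
    split=> [a|b a c|a b ab] /=; rewrite !RE; [exact: irr|exact: trp|exact: tot].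
  by move=> a b; rewrite RE; apply: ext.
have [f [fi fs fp]] := cube_widen (leq_bigmax R) (Hn R pR) pB.
by exists f; split=> // a b; rewrite fp /= RE.
Qed.

(** A two-element subalgebra, on which the operations act as [bop], has powers
    isomorphic to the power set of 'I_n with [bop] applied pointwise. *)
Lemma variety_power O (V : algebra O -> Prop) (A : algebra O) (a b : A)
    (bop : O -> bool -> bool -> bool) n :
  variety V -> V A -> a <> b ->
  (forall o x y, op o (if x then b else a) (if y then b else a) =
                 if bop o x y then b else a) ->
  V (Algebra (fun o (U W : {set 'I_n}) => [set i | bop o (i \in U) (i \in W)])).
Proof.
move=> [Vhom Vsub Vprod] VA ab opE.
pose sel x := if x then b else a.
pose P z := exists x, z = sel x.
have clP : subuniverse P.
  by move=> o _ _ [x ->] [y ->]; exists (bop o x y); apply: opE.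
pose two := subalgebra clP.
pose h (z : product (fun _ : 'I_n => two)) : {set 'I_n} :=
  [set i | excluded_middle_informative (sval (z i) = b)].
have hE z i x : sval (z i) = sel x -> (i \in h z) = x.
  rewrite inE => ->; case: excluded_middle_informative; case: x => //=.
apply: (Vhom (product (fun _ : 'I_n => two)) (Algebra _) h).
- by apply: Vprod => _; apply: Vsub => //; exists a, false.
- move=> o z z'; apply/setP=> i.
  have [x zx] := svalP (z i); have [y zy] := svalP (z' i).
  transitivity (bop o x y); first by apply: hE; rewrite /= zx zy; apply: opE.
  by rewrite -(hE z i x zx) -(hE z' i y zy); symmetry; apply: in_set.
- move=> U; exists (fun i => exist P (sel (i \in U)) (ex_intro _ (i \in U) erefl)).
  by apply/setP=> i; apply: hE.
Qed.

Lemma meet_order_poset (S : fstruct) (m : S -> S -> S) :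
  idempotent_op m -> commutative m -> associative m ->
  (forall a b, sq a b <-> m a b = a) ->
  [/\ reflexive (@sq S), antisymmetric (@sq S) & transitive (@sq S)].
Proof.
move=> id co as_ sqE; split=> [a|a b /andP[/sqE ab /sqE ba]|b a c /sqE ab /sqE bc].
- exact/sqE/id.
- by rewrite -ab co.
- by apply/sqE; rewrite -ab -as_ bc.
Qed.

Lemma strict_pair T (m : T -> T -> T) (x y : T) :
  idempotent_op m -> commutative m -> associative m -> x <> y ->
  exists a b, a <> b /\ m a b = a.
Proof.
move=> id co as_ xy; have [mx|mx] := classic (m x y = x).
  by exists x, y.
by exists (m x y), x; split=> //; rewrite co as_ id.
Qed.

Theorem theorem3p4 :
  (forall V : algebra lattice_op -> Prop,
     lattice_variety V -> nontrivial V ->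
     Ramsey_property (ordered_rel_class Meet V) /\
     ordering_property (ordered_rel_class Meet V)) /\
  (forall V : algebra semilattice_op -> Prop,
     semilattice_variety V -> nontrivial V ->
     Ramsey_property (ordered_rel_class SMeet V) /\
     ordering_property (ordered_rel_class SMeet V)).
Proof.
split=> V [varV Vax] [A VA [x [y xy]]]; apply: cube_classes.
- by move=> S [f /Vax[[id co as_] _ _ _]]; apply: meet_order_poset.
- have [[id co as_] [idj coj _] _ jm] := Vax A VA.
  have [a [b [ab mab]]] := strict_pair id co as_ xy.
  have jab : op Join a b = b by rewrite -{1}mab co coj; apply: jm.
  pose bop o := if o is Meet then andb else orb.
  have opE o u v : @op _ A o (if u then b else a) (if v then b else a) =
                   if bop o u v then b else a.
    case: o u v => [] [] [] /=; do ?[exact: id|exact: idj|exact: mab|exact: jab].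
      by rewrite co.
    by rewrite coj.
  move=> n; exists (fun o (U W : {set 'I_n}) => [set i | bop o (i \in U) (i \in W)]).
    exact: variety_power varV VA ab opE.
  by move=> U W; split=> /setIidPl.
- by move=> S [f /Vax[id co as_]]; apply: meet_order_poset.
- have [id co as_] := Vax A VA.
  have [a [b [ab mab]]] := strict_pair id co as_ xy.
  have opE o u v : @op _ A o (if u then b else a) (if v then b else a) =
                   if u && v then b else a.
    case: o u v => [] [] [] /=; do ?[exact: id|exact: mab].
    by rewrite co.
  move=> n; exists (fun o (U W : {set 'I_n}) => [set i | (i \in U) && (i \in W)]).
    exact: (@variety_power _ V A a b (fun=> andb) n).
  by move=> U W; split=> /setIidPl.
Qed.
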